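(* Let \[\mathfrak{s}_0=\Big\{\mathbf{x}\in\ell_\infty:\sum_{|\mathbf{x}(n)|\geq\epsilon}\frac{1}{n}\text{ converges for each }\epsilon>0\Big\}\quad\text{and}\quad\mathfrak{s}_{00}=\Big\{\mathbf{x}\in\ell_\infty:\sum_{\mathbf{x}(n)\neq0}\frac{1}{n}\text{ converges}\Big\}.\] Then: (1) $\mathfrak{s}_0$ is a closed ideal in $\ell_\infty$. (2) $\mathfrak{s}_0$ is non-unital. (3) $\mathfrak{s}_0$ contains $\mathfrak{s}_{00}$ as a dense subspace. (4) $\mathfrak{s}_0$ is isometrically isomorphic to $C_0(Y)$ for the subspace \[Y=\bigcup\Big\{\mathrm{cl}_{\beta\mathbb{N}}A:A\subseteq\mathbb{N}\text{ and }\sum_{n\in A}\frac{1}{n}\text{ converges}\Big\}\] of $\beta\mathbb{N}$. (5) $\mathfrak{s}_0/c_0$ contains a copy of the normed algebra $\bigoplus_{i<2^\omega}\frac{\ell_\infty}{c_0}$.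
   Context: $\mathbb{N}$ is the set of positive integers with the discrete topology and $\beta\mathbb{N}$ is its Stone–Čech compactification. $\ell_\infty$ is the normed algebra of bounded real sequences (pointwise operations, supremum norm), and $c_0$ is the set of real sequences converging to $0$. Quotients carry the quotient norm. For a space $Y$, $C_0(Y)$ is the normed algebra (supremum norm) of bounded continuous $f:Y\to\mathbb{R}$ with $|f|^{-1}([1/n,\infty))$ compact for each positive integer $n$. ''Isometrically isomorphic'' means by an isometric algebra isomorphism. An algebra is unital if it has a multiplicative unit element. For a collection $\{X_i:i\in I\}$ of normed algebras, $\bigoplus_{i\in I}X_i$ is the algebra of all families $\{x_i\}_{i\in I}$ with $x_i\in X_i$ and $x_i=0$ for all but finitely many $i$, with component-wise operations and the norm $\sup_{i\in I}\|x_i\|_{X_i}$. The index set $i<2^\omega$ has the cardinality of the continuum. ''Contains a copy of the normed algebra $B$'' means contains a subalgebra isometrically isomorphic (as algebra) to $B$. *)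

(* Defs.v *)
From HB Require Import structures.
From mathcomp Require Import all_boot all_order all_algebra.
From mathcomp Require Import generic_quotient ring_quotient.
From mathcomp Require Import all_classical all_reals all_analysis.
From mathcomp Require Import lra.

Set Implicit Arguments.
Unset Strict Implicit.
Unset Printing Implicit Defensive.

Import Order.TTheory GRing.Theory Num.Theory.
Import numFieldNormedType.Exports.

Local Open Scope classical_set_scope.
Local Open Scope ring_scope.

(* MathComp rings and algebras are unital, while most of the algebras below are
   not: the multiplication is added on top of [normedModType]. *)
HB.mixin Record hasNormedMul (R : realType) A & NormedModule R A := {
  amul : A -> A -> A;
  amulA : associative amul;
  amulDl : left_distributive amul +%R;
  amulDr : right_distributive amul +%R;
  amulZl : forall (c : R) x y, amul (c *: x) y = c *: amul x y;
  amulZr : forall (c : R) x y, amul x (c *: y) = c *: amul x y;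
  ler_norm_amul : forall x y, `|amul x y| <= `|x| * `|y| }.

#[short(type="normedAlgType")]
HB.structure Definition NormedAlg (R : realType) :=
  {A of hasNormedMul R A & NormedModule R A}.

Section amul_theory.
Context {R : realType} {A : normedAlgType R}.
Implicit Types x y z : A.

Lemma amulBl x y z : amul (x - y) z = amul x z - amul y z.
Proof. by rewrite amulDl -scaleN1r amulZl scaleN1r. Qed.

Lemma amulBr x y z : amul x (y - z) = amul x y - amul x z.
Proof. by rewrite amulDr -scaleN1r amulZr scaleN1r. Qed.

Lemma amul0l x : amul 0 x = 0.
Proof. by rewrite -[X in amul X](subrr x) amulBl subrr. Qed.

End amul_theory.

Section predicates.
Context {R : realType}.
Implicit Types A B : normedAlgType R.

Definition is_subspace (V : normedModType R) (S : set V) :=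
  [/\ S 0, (forall x y, S x -> S y -> S (x + y))
    & (forall (c : R) x, S x -> S (c *: x))].

Definition is_subalgebra A (S : set A) :=
  is_subspace S /\ (forall x y, S x -> S y -> S (amul x y)).

Definition is_ideal A (S : set A) :=
  is_subspace S /\ (forall a x, S x -> S (amul a x) /\ S (amul x a)).

Definition unital A :=
  exists e : A, forall x, amul e x = x /\ amul x e = x.

Definition isometrically_isomorphic A B :=
  exists f : {linear A -> B}, [/\ bijective f,
    (forall x y, f (amul x y) = amul (f x) (f y)) &
    (forall x, `|f x| = `|x|)].

End predicates.

Lemma ideal_subalgebra (R : realType) (A : normedAlgType R) (S : set A) :
  is_ideal S -> is_subalgebra S.
Proof. by move=> [sS iS]; split => // x y _ Sy; have [] := iS x y Sy. Qed.

Record subalgebra (R : realType) (A : normedAlgType R) := Subalgebra {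
  subalgebra_set :> set A;
  subalgebraP : is_subalgebra subalgebra_set }.

Record closed_ideal (R : realType) (A : normedAlgType R) := ClosedIdeal {
  closed_ideal_set :> set A;
  closed_idealP : is_ideal closed_ideal_set;
  closed_ideal_closed : closed closed_ideal_set }.

Section subalgebra_type.
Context {R : realType} {A : normedAlgType R} (S : subalgebra A).

Definition subalgebra_pred : {pred A} := mem (S : set A).

Lemma subalgebra_submod : submod_closed subalgebra_pred.
Proof.
have [[S0 SD SZ] _] := subalgebraP S.
split; first by rewrite inE.
by move=> c x y; rewrite !inE => Sx Sy; apply: SD => //; apply: SZ.
Qed.

HB.instance Definition _ :=
  GRing.isSubmodClosed.Build R A subalgebra_pred subalgebra_submod.

Definition subalg : Type := {x : A | x \in subalgebra_pred}.

HB.instance Definition _ := SubChoice.on subalg.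
HB.instance Definition _ := [SubChoice_isSubLmodule of subalg by <:].

Let subalg_normD (x y : subalg) : `|\val (x + y)| <= `|\val x| + `|\val y|.
Proof. by rewrite raddfD ler_normD. Qed.

Let subalg_normZ (c : R) (x : subalg) : `|\val (c *: x)| = `|c| * `|\val x|.
Proof. by rewrite linearZ normrZ. Qed.

Let subalg_norm0 (x : subalg) : `|\val x| = 0 -> x = 0.
Proof. by move=> /normr0_eq0 x0; apply: val_inj; rewrite x0 raddf0. Qed.

HB.instance Definition _ := Lmodule_isNormed.Build R subalg
  subalg_normD subalg_normZ subalg_norm0.

Lemma subalg_mul_subproof (x y : subalg) :
  amul (\val x) (\val y) \in subalgebra_pred.
Proof.
have [_ SM] := subalgebraP S.
by rewrite inE; apply: SM; [have := valP x|have := valP y]; rewrite inE.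
Qed.

Definition subalg_mul (x y : subalg) : subalg :=
  exist _ (amul (\val x) (\val y)) (subalg_mul_subproof x y).

Let smulA : associative subalg_mul.
Proof. by move=> x y z; apply: val_inj => /=; rewrite amulA. Qed.
Let smulDl : left_distributive subalg_mul +%R.
Proof. by move=> x y z; apply: val_inj => /=; rewrite amulDl. Qed.
Let smulDr : right_distributive subalg_mul +%R.
Proof. by move=> x y z; apply: val_inj => /=; rewrite amulDr. Qed.
Let smulZl (c : R) x y : subalg_mul (c *: x) y = c *: subalg_mul x y.
Proof. by apply: val_inj => /=; rewrite amulZl. Qed.
Let smulZr (c : R) x y : subalg_mul x (c *: y) = c *: subalg_mul x y.
Proof. by apply: val_inj => /=; rewrite amulZr. Qed.
Let ler_norm_smul (x y : subalg) : `|subalg_mul x y| <= `|x| * `|y|.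
Proof. exact: ler_norm_amul. Qed.

HB.instance Definition _ := hasNormedMul.Build R subalg
  smulA smulDl smulDr smulZl smulZr ler_norm_smul.

End subalgebra_type.

Definition contains_copy (R : realType) (A B : normedAlgType R) :=
  exists S : subalgebra A, isometrically_isomorphic (subalg S) B.

Section quotient_type.
Context {R : realType} {A : normedAlgType R} (I : closed_ideal A).

Definition closed_ideal_pred : {pred A} := mem (I : set A).

Lemma closed_ideal_zmod : zmod_closed closed_ideal_pred.
Proof.
have [[S0 SD SZ] _] := closed_idealP I.
split; first by rewrite inE.
move=> x y; rewrite !inE => Sx Sy.
by rewrite -scaleN1r; apply: SD => //; apply: SZ.
Qed.

HB.instance Definition _ :=
  GRing.isZmodClosed.Build A closed_ideal_pred closed_ideal_zmod.

Definition quotalg : Type := Quotient.quot closed_ideal_pred.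

HB.instance Definition _ := GRing.Zmodule.on quotalg.

Definition quot_pi (x : A) : quotalg := (\pi_(Quotient.quot closed_ideal_pred) x)%qT.
Definition quot_repr (q : quotalg) : A := repr (q : Quotient.quot closed_ideal_pred).

Lemma quot_reprK q : quot_pi (quot_repr q) = q.
Proof. exact: reprK. Qed.

Lemma quot_piP x y : quot_pi x = quot_pi y <-> (I : set A) (x - y).
Proof.
have h : (x - y \in closed_ideal_pred) = (quot_pi x == quot_pi y).
  exact: Quotient.idealrBE.
split=> [xy|Ixy]; first by apply: set_mem; apply: etrans h _; rewrite xy eqxx.
by apply/eqP; rewrite -h; exact/mem_set.
Qed.

Lemma quot_piD x y : quot_pi (x + y) = quot_pi x + quot_pi y.
Proof. by rewrite /quot_pi raddfD. Qed.

Lemma quot_piB x y : quot_pi (x - y) = quot_pi x - quot_pi y.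
Proof. by rewrite /quot_pi raddfB. Qed.

Lemma quot_pi0 : quot_pi 0 = 0.
Proof. by rewrite /quot_pi raddf0. Qed.

Definition quot_scale (c : R) (q : quotalg) : quotalg :=
  quot_pi (c *: quot_repr q).

Definition quot_mul (p q : quotalg) : quotalg :=
  quot_pi (amul (quot_repr p) (quot_repr q)).

Definition quot_norm (q : quotalg) : R := inf [set `|x| | x in quot_pi @^-1` [set q]].

Lemma quot_piZ c x : quot_scale c (quot_pi x) = quot_pi (c *: x).
Proof.
have [[_ _ SZ] _] := closed_idealP I.
apply/quot_piP; rewrite -scalerBr; apply: SZ.
by apply/quot_piP; rewrite quot_reprK.
Qed.

Lemma quot_piM x y : quot_mul (quot_pi x) (quot_pi y) = quot_pi (amul x y).
Proof.
have [[_ SD SZ] SM] := closed_idealP I.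
have Ix : (I : set A) (quot_repr (quot_pi x) - x) by apply/quot_piP; rewrite quot_reprK.
have Iy : (I : set A) (quot_repr (quot_pi y) - y) by apply/quot_piP; rewrite quot_reprK.
apply/quot_piP.
set x' := quot_repr _ in Ix *; set y' := quot_repr _ in Iy *.
have -> : amul x' y' - amul x y = amul (x' - x) y' + amul x (y' - y).
  by rewrite amulBl amulBr addrA subrK.
by apply: SD; [exact: (SM _ _ Ix).2|exact: (SM _ _ Iy).1].
Qed.

Lemma quot_surj q : exists x, quot_pi x = q.
Proof. by exists (quot_repr q); exact: quot_reprK. Qed.

Let qscaleA a b q : quot_scale a (quot_scale b q) = quot_scale (a * b) q.
Proof. by have [x <-] := quot_surj q; rewrite !quot_piZ scalerA. Qed.
Let qscale1 : left_id 1 quot_scale.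
Proof. by move=> q; have [x <-] := quot_surj q; rewrite quot_piZ scale1r. Qed.
Let qscaleDr : right_distributive quot_scale +%R.
Proof.
move=> a p q; have [x <-] := quot_surj p; have [y <-] := quot_surj q.
by rewrite -quot_piD !quot_piZ scalerDr quot_piD.
Qed.
Let qscaleDl v : {morph quot_scale^~ v : a b / a + b}.
Proof.
move=> a b; have [x <-] := quot_surj v.
by rewrite !quot_piZ scalerDl quot_piD.
Qed.

HB.instance Definition _ := GRing.Zmodule_isLmodule.Build R quotalg
  qscaleA qscale1 qscaleDr qscaleDl.

Let has_inf_quot q : has_inf [set `|x| | x in quot_pi @^-1` [set q]].
Proof.
have [x xq] := quot_surj q; split; first by exists `|x|, x.
by exists 0 => _ [y _ <-].
Qed.

Lemma quot_norm_le x : quot_norm (quot_pi x) <= `|x|.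
Proof. by apply: ge_inf; [exact: (has_inf_quot _).2|exists x]. Qed.

Lemma quot_norm_ge0 q : 0 <= quot_norm q.
Proof. by apply: lb_le_inf; [exact: (has_inf_quot q).1|move=> _ [y _ <-]]. Qed.

Lemma quot_norm_adherent q (e : R) : 0 < e ->
  exists2 x, quot_pi x = q & `|x| < quot_norm q + e.
Proof.
by move=> /inf_adherent/(_ (has_inf_quot q)) [_ [x xq <-]]; exists x.
Qed.

Let quot_normD p q : quot_norm (p + q) <= quot_norm p + quot_norm q.
Proof.
apply/ler_addgt0Pr => e e0.
have e20 : 0 < e / 2 by rewrite divr_gt0.
have [x <- xp] := quot_norm_adherent p e20.
have [y <- yq] := quot_norm_adherent q e20.
rewrite -quot_piD; apply: le_trans (quot_norm_le _) _.
apply: le_trans (ler_normD _ _) _; rewrite [e]splitr addrACA.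
by apply: lerD; apply: ltW.
Qed.

Let quot_normZ_le c q : quot_norm (c *: q) <= `|c| * quot_norm q.
Proof.
have qN (x : A) : c *: quot_pi x = quot_pi (c *: x) by exact: quot_piZ.
have [->|c0] := eqVneq c 0.
  rewrite scale0r -quot_pi0 normr0 mul0r.
  by apply: le_trans (quot_norm_le _) _; rewrite normr0.
have nc0 : 0 < `|c| by rewrite normr_gt0.
apply/ler_addgt0Pr => e e0.
have [x xq xn] := quot_norm_adherent q (divr_gt0 e0 nc0).
rewrite -{1}xq qN; apply: le_trans (quot_norm_le _) _.
rewrite normrZ -ler_pdivlMl// mulrDr mulKf ?gt_eqF//.
by rewrite mulrC ltW.
Qed.

Let quot_normZ c q : quot_norm (c *: q) = `|c| * quot_norm q.
Proof.
have [->|c0] := eqVneq c 0.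
  apply/eqP; rewrite eq_le quot_normZ_le normr0 mul0r.
  exact: quot_norm_ge0.
have nc0 : 0 < `|c| by rewrite normr_gt0.
apply/eqP; rewrite eq_le quot_normZ_le /=.
rewrite -ler_pdivlMl// -normfV.
by rewrite -{1}[q](scalerK c0) quot_normZ_le.
Qed.

Let quot_norm0 q : quot_norm q = 0 -> q = 0.
Proof.
have [x <-] := quot_surj q => nx0.
rewrite -quot_pi0; apply/quot_piP; rewrite subr0.
rewrite ((closure_id (I : set A)).1 (@closed_ideal_closed _ _ I)) => B /nbhs_ballP[e /= e0 eB].
have [y yx] := quot_norm_adherent (quot_pi x) e0.
rewrite nx0 add0r => ye; exists (x - y); split.
  exact/quot_piP.
by apply: eB; rewrite -ball_normE /= opprB addrC subrK.
Qed.

HB.instance Definition _ := Lmodule_isNormed.Build R quotalg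
  quot_normD quot_normZ quot_norm0.

Let qmulA : associative quot_mul.
Proof.
move=> p q r; have [x <-] := quot_surj p; have [y <-] := quot_surj q.
by have [z <-] := quot_surj r; rewrite !quot_piM amulA.
Qed.
Let qmulDl : left_distributive quot_mul +%R.
Proof.
move=> p q r; have [x <-] := quot_surj p; have [y <-] := quot_surj q.
by have [z <-] := quot_surj r; rewrite -quot_piD !quot_piM amulDl quot_piD.
Qed.
Let qmulDr : right_distributive quot_mul +%R.
Proof.
move=> p q r; have [x <-] := quot_surj p; have [y <-] := quot_surj q.
by have [z <-] := quot_surj r; rewrite -quot_piD !quot_piM amulDr quot_piD.
Qed.
Let qmulZl (c : R) p q : quot_mul (c *: p) q = c *: quot_mul p q.
Proof.
have [x <-] := quot_surj p; have [y <-] := quot_surj q.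
by rewrite [c *: quot_pi x]quot_piZ !quot_piM amulZl [RHS]quot_piZ.
Qed.
Let qmulZr (c : R) p q : quot_mul p (c *: q) = c *: quot_mul p q.
Proof.
have [x <-] := quot_surj p; have [y <-] := quot_surj q.
by rewrite [c *: quot_pi y]quot_piZ !quot_piM amulZr [RHS]quot_piZ.
Qed.

Let ler_norm_qmul (p q : quotalg) : `|quot_mul p q| <= `|p| * `|q|.
Proof.
rewrite -[`|quot_mul p q|]/(quot_norm _) -[`|p|]/(quot_norm _) -[`|q|]/(quot_norm _).
have pr e : 0 < e -> quot_norm (quot_mul p q) <= (quot_norm p + e) * (quot_norm q + e).
  move=> e0; have [x <- xp] := quot_norm_adherent p e0.
  have [y <- yq] := quot_norm_adherent q e0.
  rewrite quot_piM; apply: le_trans (quot_norm_le _) _.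
  by apply: le_trans (ler_norm_amul _ _) _; apply: ler_pM => //; exact: ltW.
have a0 := quot_norm_ge0 p; have b0 := quot_norm_ge0 q.
rewrite leNgt; apply/negP => ltc.
set a := quot_norm p in pr a0 ltc *; set b := quot_norm q in pr b0 ltc *.
set c := quot_norm _ in pr ltc *.
have ab1 : 0 < a + b + 1 by rewrite ltr_wpDl// addr_ge0.
pose d := Num.min 1 ((c - a * b) / (2 * (a + b + 1))).
have d0 : 0 < d by rewrite lt_min ltr01 divr_gt0 ?subr_gt0 ?mulr_gt0.
have d1 : d <= 1 by rewrite ge_min lexx.
have dc : d * (2 * (a + b + 1)) <= c - a * b.
  by rewrite -ler_pdivlMr ?mulr_gt0// ge_min lexx orbT.
have := pr d d0; nra.
Qed.

HB.instance Definition _ := hasNormedMul.Build R quotalg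
  qmulA qmulDl qmulDr qmulZl qmulZr ler_norm_qmul.

End quotient_type.

Section direct_sum.
Context {R : realType} {I : Type} (X : I -> normedAlgType R).

Record dsum := DSum {
  dsum_fun :> forall i, X i;
  dsum_finite : finite_set [set i | dsum_fun i <> 0] }.

HB.instance Definition _ := gen_eqMixin dsum.
HB.instance Definition _ := gen_choiceMixin dsum.

Lemma dsumP (x y : dsum) : (forall i, x i = y i) -> x = y.
Proof.
case: x y => [x xf] [y yf] /= xy.
have {}xy : x = y by exact: functional_extensionality_dep.
by subst y; congr DSum; exact: Prop_irrelevance.
Qed.

Lemma dsum0_subproof : finite_set [set i | (0 : X i) <> 0].
Proof. by rewrite (_ : [set _ | _] = set0)// -subset0 => i /=. Qed.

Lemma dsumN_subproof (x : dsum) : finite_set [set i | - x i <> 0].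
Proof.
apply: sub_finite_set (dsum_finite x) => i /= xi0 x0.
by apply: xi0; rewrite x0 oppr0.
Qed.

Lemma dsumD_subproof (x y : dsum) : finite_set [set i | x i + y i <> 0].
Proof.
apply: (@sub_finite_set _ _ ([set i | x i <> 0] `|` [set i | y i <> 0])).
  move=> i /= xy0; have [xi0|] := pselect (x i = 0); last by left.
  by right => yi0; apply: xy0; rewrite xi0 yi0 addr0.
by rewrite finite_setU; split; exact: dsum_finite.
Qed.

Lemma dsumZ_subproof (c : R) (x : dsum) : finite_set [set i | c *: x i <> 0].
Proof.
apply: sub_finite_set (dsum_finite x) => i /= xi0 x0.
by apply: xi0; rewrite x0 scaler0.
Qed.

Lemma dsumM_subproof (x y : dsum) :
  finite_set [set i | amul (x i) (y i) <> 0].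
Proof.
apply: sub_finite_set (dsum_finite x) => i /= xi0 x0.
by apply: xi0; rewrite x0 amul0l.
Qed.

Definition dsum0 : dsum := DSum dsum0_subproof.
Definition dsumN x : dsum := DSum (dsumN_subproof x).
Definition dsumD x y : dsum := DSum (dsumD_subproof x y).
Definition dsumZ c x : dsum := DSum (dsumZ_subproof c x).
Definition dsumM x y : dsum := DSum (dsumM_subproof x y).

Let daddA : associative dsumD.
Proof. by move=> x y z; apply: dsumP => i /=; rewrite addrA. Qed.
Let daddC : commutative dsumD.
Proof. by move=> x y; apply: dsumP => i /=; rewrite addrC. Qed.
Let dadd0 : left_id dsum0 dsumD.
Proof. by move=> x; apply: dsumP => i /=; rewrite add0r. Qed.
Let daddN : left_inverse dsum0 dsumN dsumD.
Proof. by move=> x; apply: dsumP => i /=; rewrite addNr. Qed.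

HB.instance Definition _ := GRing.isZmodule.Build dsum daddA daddC dadd0 daddN.

Let dscaleA a b x : dsumZ a (dsumZ b x) = dsumZ (a * b) x.
Proof. by apply: dsumP => i /=; rewrite scalerA. Qed.
Let dscale1 : left_id 1 dsumZ.
Proof. by move=> x; apply: dsumP => i /=; rewrite scale1r. Qed.
Let dscaleDr : right_distributive dsumZ +%R.
Proof. by move=> a x y; apply: dsumP => i /=; rewrite scalerDr. Qed.
Let dscaleDl v : {morph dsumZ^~ v : a b / a + b}.
Proof. by move=> a b; apply: dsumP => i /=; rewrite scalerDl. Qed.

HB.instance Definition _ := GRing.Zmodule_isLmodule.Build R dsum
  dscaleA dscale1 dscaleDr dscaleDl.

(* The supremum of an empty set is 0, so this is also the intended norm when
   [I] is empty. *)
Definition dsum_norm (x : dsum) : R := sup [set `|x i| | i in setT].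

Let dsum_ubound (x : dsum) : has_ubound [set `|x i| | i in setT].
Proof.
have /finite_seqP[s sE] := finite_image (fun i => `|x i|) (dsum_finite x).
exists (\big[Num.max/0]_(r <- s) r) => _ [i _ <-].
have [->|xi0] := pselect (x i = 0); first by rewrite normr0 bigmax_ge_id.
have xis : `|x i| \in s.
  have : [set `|x i| | i in [set i | x i <> 0]] `|x i| by exists i.
  by rewrite sE.
exact: (@Order.TotalTheory.le_bigmax_seq _ _ _ _ 0 _ predT id xis isT).
Qed.

Lemma dsum_norm_ge (x : dsum) i : `|x i| <= dsum_norm x.
Proof. by apply: ub_le_sup; [exact: dsum_ubound|exists i]. Qed.

Lemma dsum_norm_le (x : dsum) (M : R) :
  0 <= M -> (forall i, `|x i| <= M) -> dsum_norm x <= M.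
Proof.
move=> M0 xM; rewrite /dsum_norm.
have [->|/set0P ne] := eqVneq [set `|x i| | i in setT] set0.
  by rewrite sup0.
by apply: ge_sup => // _ [i _ <-].
Qed.

Lemma dsum_norm_ge0 (x : dsum) : 0 <= dsum_norm x.
Proof.
have [E|/set0P[_ [i _ _]]] := eqVneq [set `|x i| | i in setT] set0.
  by rewrite /dsum_norm E sup0.
exact: le_trans (normr_ge0 (x i)) (dsum_norm_ge x i).
Qed.

Let dsum_normD (x y : dsum) : dsum_norm (x + y) <= dsum_norm x + dsum_norm y.
Proof.
apply: dsum_norm_le => [|i]; first by rewrite addr_ge0// dsum_norm_ge0.
by apply: le_trans (ler_normD _ _) _; apply: lerD; exact: dsum_norm_ge.
Qed.

Let dsum_normZ c (x : dsum) : dsum_norm (c *: x) = `|c| * dsum_norm x.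
Proof.
have le a (y : dsum) : dsum_norm (a *: y) <= `|a| * dsum_norm y.
  apply: dsum_norm_le => [|i]; first by rewrite mulr_ge0// dsum_norm_ge0.
  by rewrite normrZ ler_wpM2l// dsum_norm_ge.
have [->|c0] := eqVneq c 0.
  apply/eqP; rewrite eq_le le normr0 mul0r; exact: dsum_norm_ge0.
apply/eqP; rewrite eq_le le /= -ler_pdivlMl ?normr_gt0// -normfV.
by rewrite -{1}[x](scalerK c0) le.
Qed.

Let dsum_norm0 (x : dsum) : dsum_norm x = 0 -> x = 0.
Proof.
move=> x0; apply: dsumP => i /=; apply/eqP; rewrite -normr_le0 -x0.
exact: dsum_norm_ge.
Qed.

HB.instance Definition _ := Lmodule_isNormed.Build R dsum
  dsum_normD dsum_normZ dsum_norm0.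

Let dmulA : associative dsumM.
Proof. by move=> x y z; apply: dsumP => i /=; rewrite amulA. Qed.
Let dmulDl : left_distributive dsumM +%R.
Proof. by move=> x y z; apply: dsumP => i /=; rewrite amulDl. Qed.
Let dmulDr : right_distributive dsumM +%R.
Proof. by move=> x y z; apply: dsumP => i /=; rewrite amulDr. Qed.
Let dmulZl (c : R) x y : dsumM (c *: x) y = c *: dsumM x y.
Proof. by apply: dsumP => i /=; rewrite amulZl. Qed.
Let dmulZr (c : R) x y : dsumM x (c *: y) = c *: dsumM x y.
Proof. by apply: dsumP => i /=; rewrite amulZr. Qed.
Let ler_norm_dmul (x y : dsum) : `|dsumM x y| <= `|x| * `|y|.
Proof.
rewrite -[leLHS]/(dsum_norm _) -[`|x|]/(dsum_norm _) -[`|y|]/(dsum_norm _).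
apply: dsum_norm_le => [|i]; first by rewrite mulr_ge0// dsum_norm_ge0.
by apply: le_trans (ler_norm_amul _ _) _; apply: ler_pM => //; exact: dsum_norm_ge.
Qed.

HB.instance Definition _ := hasNormedMul.Build R dsum
  dmulA dmulDl dmulDr dmulZl dmulZr ler_norm_dmul.

End direct_sum.

Section bounded_functions.
Context {R : realType} (T : Type).

Record bfun := BFun {
  bfun_fun :> T -> R;
  bfun_bounded : bounded_fun bfun_fun }.

HB.instance Definition _ := gen_eqMixin bfun.
HB.instance Definition _ := gen_choiceMixin bfun.

Lemma bfunP (f g : bfun) : f =1 g -> f = g.
Proof.
case: f g => [f bf] [g bg] /= /funext fg.
by subst g; congr BFun; exact: Prop_irrelevance.
Qed.

Lemma bounded_funP (f : T -> R) :
  bounded_fun f <-> exists M : R, forall t, `|f t| <= M.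
Proof.
split=> [[M [_ fM]]|[M fM]].
  by exists (M + 1) => t; apply: (fM (M + 1)); rewrite ?ltrDl.
exists M; split; first exact: num_real.
by move=> N MN t _; exact: le_trans (fM t) (ltW MN).
Qed.

Lemma bfun0_subproof : bounded_fun (fun _ : T => 0 : R).
Proof. by apply/bounded_funP; exists 0 => t; rewrite normr0. Qed.

Lemma bfunN_subproof (f : bfun) : bounded_fun (fun t => - f t).
Proof.
have /bounded_funP[M fM] := bfun_bounded f.
by apply/bounded_funP; exists M => t; rewrite normrN.
Qed.

Lemma bfunD_subproof (f g : bfun) : bounded_fun (fun t => f t + g t).
Proof.
have /bounded_funP[M fM] := bfun_bounded f.
have /bounded_funP[N gN] := bfun_bounded g.
apply/bounded_funP; exists (M + N) => t.
by apply: le_trans (ler_normD _ _) _; apply: lerD.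
Qed.

Lemma bfunZ_subproof (c : R) (f : bfun) : bounded_fun (fun t => c * f t).
Proof.
have /bounded_funP[M fM] := bfun_bounded f.
apply/bounded_funP; exists (`|c| * M) => t.
by rewrite normrM ler_wpM2l.
Qed.

Lemma bfunM_subproof (f g : bfun) : bounded_fun (fun t => f t * g t).
Proof.
have /bounded_funP[M fM] := bfun_bounded f.
have /bounded_funP[N gN] := bfun_bounded g.
apply/bounded_funP; exists (M * N) => t.
by rewrite normrM; apply: ler_pM.
Qed.

Definition bfun0 : bfun := BFun bfun0_subproof.
Definition bfunN f : bfun := BFun (bfunN_subproof f).
Definition bfunD f g : bfun := BFun (bfunD_subproof f g).
Definition bfunZ c f : bfun := BFun (bfunZ_subproof c f).
Definition bfunM f g : bfun := BFun (bfunM_subproof f g).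

Let baddA : associative bfunD.
Proof. by move=> x y z; apply: bfunP => i /=; rewrite addrA. Qed.
Let baddC : commutative bfunD.
Proof. by move=> x y; apply: bfunP => i /=; rewrite addrC. Qed.
Let badd0 : left_id bfun0 bfunD.
Proof. by move=> x; apply: bfunP => i /=; rewrite add0r. Qed.
Let baddN : left_inverse bfun0 bfunN bfunD.
Proof. by move=> x; apply: bfunP => i /=; rewrite addNr. Qed.

HB.instance Definition _ := GRing.isZmodule.Build bfun baddA baddC badd0 baddN.

Let bscaleA a b x : bfunZ a (bfunZ b x) = bfunZ (a * b) x.
Proof. by apply: bfunP => i /=; rewrite mulrA. Qed.
Let bscale1 : left_id 1 bfunZ.
Proof. by move=> x; apply: bfunP => i /=; rewrite mul1r. Qed.
Let bscaleDr : right_distributive bfunZ +%R.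
Proof. by move=> a x y; apply: bfunP => i /=; rewrite mulrDr. Qed.
Let bscaleDl v : {morph bfunZ^~ v : a b / a + b}.
Proof. by move=> a b; apply: bfunP => i /=; rewrite mulrDl. Qed.

HB.instance Definition _ := GRing.Zmodule_isLmodule.Build R bfun
  bscaleA bscale1 bscaleDr bscaleDl.

Definition bfun_norm (f : bfun) : R := sup [set `|f t| | t in setT].

Lemma bfun_norm_ge (f : bfun) t : `|f t| <= bfun_norm f.
Proof.
apply: ub_le_sup; last by exists t.
have /bounded_funP[M fM] := bfun_bounded f.
by exists M => _ [s _ <-].
Qed.

Lemma bfun_norm_le (f : bfun) (M : R) :
  0 <= M -> (forall t, `|f t| <= M) -> bfun_norm f <= M.
Proof.
move=> M0 fM; rewrite /bfun_norm.
have [->|/set0P ne] := eqVneq [set `|f t| | t in setT] set0.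
  by rewrite sup0.
by apply: ge_sup => // _ [i _ <-].
Qed.

Lemma bfun_norm_ge0 (f : bfun) : 0 <= bfun_norm f.
Proof.
have [E|/set0P[_ [i _ _]]] := eqVneq [set `|f t| | t in setT] set0.
  by rewrite /bfun_norm E sup0.
exact: le_trans (normr_ge0 (f i)) (bfun_norm_ge f i).
Qed.

Let bfun_normD (x y : bfun) : bfun_norm (x + y) <= bfun_norm x + bfun_norm y.
Proof.
apply: bfun_norm_le => [|i]; first by rewrite addr_ge0// bfun_norm_ge0.
by apply: le_trans (ler_normD _ _) _; apply: lerD; exact: bfun_norm_ge.
Qed.

Let bfun_normZ c (x : bfun) : bfun_norm (c *: x) = `|c| * bfun_norm x.
Proof.
have le a (y : bfun) : bfun_norm (a *: y) <= `|a| * bfun_norm y.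
  apply: bfun_norm_le => [|i]; first by rewrite mulr_ge0// bfun_norm_ge0.
  by rewrite normrM ler_wpM2l// bfun_norm_ge.
have [->|c0] := eqVneq c 0.
  apply/eqP; rewrite eq_le le normr0 mul0r; exact: bfun_norm_ge0.
apply/eqP; rewrite eq_le le /= -ler_pdivlMl ?normr_gt0// -normfV.
by rewrite -{1}[x](scalerK c0) le.
Qed.

Let bfun_norm0 (x : bfun) : bfun_norm x = 0 -> x = 0.
Proof.
move=> x0; apply: bfunP => i /=; apply/eqP; rewrite -normr_le0 -x0.
exact: bfun_norm_ge.
Qed.

HB.instance Definition _ := Lmodule_isNormed.Build R bfun
  bfun_normD bfun_normZ bfun_norm0.

Let bmulA : associative bfunM.
Proof. by move=> x y z; apply: bfunP => i /=; rewrite mulrA. Qed.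
Let bmulDl : left_distributive bfunM +%R.
Proof. by move=> x y z; apply: bfunP => i /=; rewrite mulrDl. Qed.
Let bmulDr : right_distributive bfunM +%R.
Proof. by move=> x y z; apply: bfunP => i /=; rewrite mulrDr. Qed.
Let bmulZl (c : R) x y : bfunM (c *: x) y = c *: bfunM x y.
Proof. by apply: bfunP => i /=; rewrite mulrA. Qed.
Let bmulZr (c : R) x y : bfunM x (c *: y) = c *: bfunM x y.
Proof. by apply: bfunP => i /=; rewrite mulrCA. Qed.
Let ler_norm_bmul (x y : bfun) : `|bfunM x y| <= `|x| * `|y|.
Proof.
rewrite -[leLHS]/(bfun_norm _) -[`|x|]/(bfun_norm _) -[`|y|]/(bfun_norm _).
apply: bfun_norm_le => [|i]; first by rewrite mulr_ge0// bfun_norm_ge0.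
by rewrite normrM; apply: ler_pM => //; exact: bfun_norm_ge.
Qed.

HB.instance Definition _ := hasNormedMul.Build R bfun
  bmulA bmulDl bmulDr bmulZl bmulZr ler_norm_bmul.

End bounded_functions.
Arguments bfun R T : clear implicits.

Section restricted_ideal.
Context {R : realType} {A : normedAlgType R}.
Variables (S : subalgebra A) (I : closed_ideal A).

Definition restricted_ideal_set : set (subalg S) :=
  [set x | (I : set A) (\val x)].

Lemma restricted_ideal_is_ideal : is_ideal restricted_ideal_set.
Proof.
have [[I0 ID IZ] IM] := closed_idealP I.
split=> [|a x Ix]; last by split; [exact: (IM _ _ Ix).1|exact: (IM _ _ Ix).2].
split; first exact: I0.
  by move=> x y; exact: ID.
by move=> c x; exact: IZ.
Qed.

Lemma restricted_ideal_closed : closed restricted_ideal_set.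
Proof.
move=> x clx; rewrite /restricted_ideal_set /=.
rewrite ((closure_id (I : set A)).1 (@closed_ideal_closed _ _ I)).
move=> B /nbhs_ballP[e /= e0 eB].
have [y [Iy xy]] := clx _ (nbhsx_ballx x e e0).
exists (\val y); split => //; apply: eB.
by move: xy; rewrite -!ball_normE.
Qed.

Definition restricted_ideal : closed_ideal (subalg S) :=
  ClosedIdeal restricted_ideal_is_ideal restricted_ideal_closed.

End restricted_ideal.

Section C0.
Context {R : realType} (X : topologicalType).

Definition C0_set : set (bfun R X) :=
  [set f | continuous f /\
           forall n : nat, compact [set x | n.+1%:R^-1 <= `|f x|]].

Let C0_compact (f : bfun R X) (e : R) :
  C0_set f -> 0 < e -> compact [set x | e <= `|f x|].
Proof.
move=> [cf Cf] e0.
have [n ne] : exists n : nat, n.+1%:R^-1 <= e.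
  exists (Num.truncn e^-1); rewrite -[leRHS]invrK lef_pV2 ?posrE ?invr_gt0//.
  by rewrite ltW// truncnS_gt.
apply: subclosed_compact (Cf n) _ => [|x /=]; last exact: le_trans.
have cnf : continuous (fun x => `|f x|).
  by move=> x; apply: continuous_comp (cf x) _; exact: norm_continuous.
exact: (continuous_closedP _).1 cnf _ (@closed_ge _ e).
Qed.

Let C0_le (f : bfun R X) (A : set X) (n : nat) : continuous f -> compact A ->
  [set x | n.+1%:R^-1 <= `|f x|] `<=` A ->
  compact [set x | n.+1%:R^-1 <= `|f x|].
Proof.
move=> cf cA fA; apply: subclosed_compact cA fA.
have cnf : continuous (fun x => `|f x|).
  by move=> x; apply: continuous_comp (cf x) _; exact: norm_continuous.
exact: (continuous_closedP _).1 cnf _ (@closed_ge _ n.+1%:R^-1).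
Qed.

Lemma C0_subalgebra : is_subalgebra C0_set.
Proof.
have H n : (0 : R) < n.+1%:R^-1 by rewrite invr_gt0.
split; first split.
- split=> [|n]; first by move=> x; exact: cvg_cst.
  rewrite (_ : [set _ | _] = set0); first exact: compact0.
  by rewrite -subset0 => x /=; rewrite normr0 leNgt H.
- move=> f g Cf Cg; have cfg : continuous (f + g : bfun R X).
    by move=> x; apply: cvgD; [exact: Cf.1|exact: Cg.1].
  split=> // n; have n2 : 0 < n.+1%:R^-1 / 2 :> R by rewrite divr_gt0.
  apply: C0_le cfg (compactU (C0_compact Cf n2) (C0_compact Cg n2)) _.
  move=> x /= nx; have [fx|fx] := leP (n.+1%:R^-1 / 2) `|f x|; first by left.
  right; rewrite leNgt; apply/negP => gx; move: nx; rewrite leNgt => /negP.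
  by apply; rewrite [ltRHS]splitr; exact: le_lt_trans (ler_normD _ _) (ltrD fx gx).
- move=> c f Cf; have ccf : continuous (c *: f : bfun R X).
    by move=> x; apply: cvgM; [exact: cvg_cst|exact: Cf.1].
  split=> // n; have c1 : 0 < `|c| + 1 by rewrite ltr_wpDl.
  apply: C0_le ccf (C0_compact Cf (divr_gt0 (H n) c1)) _.
  move=> x /= nx; rewrite ler_pdivrMr//; apply: le_trans nx _.
  by rewrite normrM mulrC ler_wpM2l// lerDl.
- move=> f g Cf Cg; have cfg : continuous (amul f g : bfun R X).
    by move=> x; apply: cvgM; [exact: Cf.1|exact: Cg.1].
  split=> // n; have c1 : 0 < `|g| + 1 by rewrite ltr_wpDl.
  apply: C0_le cfg (C0_compact Cf (divr_gt0 (H n) c1)) _.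
  move=> x /= nx; rewrite ler_pdivrMr//; apply: le_trans nx _.
  rewrite normrM ler_wpM2l//; apply: le_trans (bfun_norm_ge g x) _.
  by rewrite lerDl.
Qed.

Definition C0 : subalgebra (bfun R X) := Subalgebra C0_subalgebra.

End C0.
Arguments C0 R X : clear implicits.

(* The closure of the image of [X] in the product of the functions
   [f : X -> [0, 1]]; it does not matter that each factor is [R] rather than
   [0, 1], since the product of the intervals [0, 1] is closed. *)
Section stone_cech.
Variables (R : realType) (X : topologicalType).

Definition unit_cfun : Type :=
  {f : X -> R | continuous f /\ forall x, 0 <= f x <= 1}.

HB.instance Definition _ := gen_eqMixin unit_cfun.
HB.instance Definition _ := gen_choiceMixin unit_cfun.

Definition stone_cech_eval (x : X) : {ptws unit_cfun -> R} :=
  fun f => sval f x.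

Definition stone_cech := set_type (closure (range stone_cech_eval)).

HB.instance Definition _ := Topological.on stone_cech.

Lemma stone_cech_emb_subproof x :
  stone_cech_eval x \in closure (range stone_cech_eval).
Proof. by apply/mem_set; apply: subset_closure; exists x. Qed.

Definition stone_cech_emb (x : X) : stone_cech :=
  exist _ (stone_cech_eval x) (stone_cech_emb_subproof x).

End stone_cech.

Section stone_cech_theory.
Context (R : realType) (X : topologicalType).
Let evc : set {ptws unit_cfun R X -> R} := closure (range (@stone_cech_eval R X)).

Let evc_compact : compact evc.
Proof.
have cK : compact ([set h | forall f, `[0, 1]%classic (h f)] : set {ptws unit_cfun R X -> R}).
  apply: (@tychonoff (unit_cfun R X) (fun _ => R) (fun _ => `[0, 1]%classic)).
  by move=> f; exact: segment_compact.
apply: (subclosed_compact _ cK); first exact: closed_closure.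
apply: (@subset_trans _ (closure [set h : {ptws unit_cfun R X -> R} | forall f, `[0, 1]%classic (h f)])).
  by apply: closureS => _ [x _ <-] f /=; rewrite in_itv/=; exact: (svalP f).2.
apply: compact_closed (cK).
by apply: hausdorff_product => f; exact: Rhausdorff.
Qed.

Lemma stone_cech_compact : compact [set: stone_cech R X].
Proof.
move=> F FF _.
pose v : stone_cech R X -> {ptws unit_cfun R X -> R} := set_val.
have [|p [Cp clp]] := @evc_compact (v @ F) (fmap_proper_filter v FF).
  by rewrite /nbhs /=; near=> x; exact: set_mem (valP x).
exists (exist _ p (mem_set Cp)); split=> // A B FA.
move=> [_ [[B' oB' <-] /= B'p] sB].
have [||q [[a Aa aq] B'q]] := clp (v @` A) B'.
- by apply: (@filterS _ F _ A _ _ FA) => a Aa; exists a.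
- exact: open_nbhs_nbhs.
- by exists a; split => //; apply: sB; rewrite /preimage /= -[set_val a]/(v a) aq.
Unshelve. all: by end_near. Qed.

Lemma stone_cech_hausdorff : hausdorff_space (stone_cech R X).
Proof.
have hp : hausdorff_space {ptws unit_cfun R X -> R}.
  by apply: hausdorff_product => f; exact: Rhausdorff.
move=> p q pq; apply: val_inj; apply: hp => A B Ap Bq.
have vc := @initial_continuous (stone_cech R X) _ set_val.
have [r [Ar Br]] := pq _ _ (vc p A Ap) (vc q B Bq).
by exists (set_val r).
Qed.

Lemma stone_cech_dense : dense (range (@stone_cech_emb R X)).
Proof.
move=> O [p Op] [W oW OE].
have := set_valP p; rewrite /closure /= => /(_ W).
have Wp : W (set_val p) by move: Op; rewrite -OE.
move=> /(_ (open_nbhs_nbhs (conj oW Wp))) [_ [[x _ <-] Wx]].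
by exists (stone_cech_emb R x); split; [rewrite -OE|exists x].
Qed.

Lemma stone_cech_emb_continuous : continuous (@stone_cech_emb R X).
Proof.
apply: continuous_comp_initial => x.
apply/cvg_sup => f U [_ [[V oV <-] /= Vx] VU].
apply: filterS VU _; apply: (svalP f).1; exact: open_nbhs_nbhs.
Qed.

Lemma stone_cech_ext (f : X -> R) : continuous f -> (forall x, 0 <= f x <= 1) ->
  exists g : stone_cech R X -> R, continuous g /\ forall x, g (stone_cech_emb R x) = f x.
Proof.
move=> cf f01; pose F : unit_cfun R X := exist _ f (conj cf f01).
exists (fun p => (set_val p : {ptws unit_cfun R X -> R}) F); split => // p.
apply: (@continuous_comp _ _ _ (set_val : stone_cech R X -> {ptws unit_cfun R X -> R}) (fun h => h F)).
  exact: initial_continuous.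
exact: proj_continuous.
Qed.
End stone_cech_theory.

(* The positive integer n is encoded by the natural number n - 1: thus
   [harmonic k = k.+1%:R^-1] is the weight 1/n for n = k + 1, and a sequence
   (x(1), x(2), ...) is a function on [nat]. *)
Section sequence_algebras.
Context {R : realType}.

Local Notation ell_inf := (bfun R nat).

Definition harmonic_summable (A : set nat) :=
  cvgn (series (fun n => \1_A n * harmonic n : R)).

Definition c0_set : set ell_inf := [set x : ell_inf | x n @[n --> \oo] --> (0 : R)].

Definition s0_set : set ell_inf :=
  [set x | forall e : R, 0 < e ->
    harmonic_summable [set n | e <= `|x n|]].

Definition s00_set : set ell_inf :=
  [set x | harmonic_summable [set n | x n != 0]].

Lemma harmonic_summable_sub (A B : set nat) :
  A `<=` B -> harmonic_summable B -> harmonic_summable A.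
Proof.
move=> AB; apply: series_le_cvg => n.
- by rewrite mulr_ge0// harmonic_ge0.
- by rewrite mulr_ge0// harmonic_ge0.
- rewrite ler_wpM2r ?harmonic_ge0// !indicE ler_nat.
  by case: (boolP (n \in A)) => // /set_mem/AB/mem_set ->.
Qed.

Lemma harmonic_summableU (A B : set nat) :
  harmonic_summable A -> harmonic_summable B -> harmonic_summable (A `|` B).
Proof.
move=> sA sB; have := is_cvg_seriesD sA sB.
apply: series_le_cvg => n.
- by rewrite mulr_ge0// harmonic_ge0.
- by rewrite addr_ge0// mulr_ge0// harmonic_ge0.
- rewrite -[leRHS]/(_ * _ + _ * _) -mulrDl ler_wpM2r ?harmonic_ge0//.
  by rewrite !indicE -natrD ler_nat in_setU; do 2 case: (_ \in _).
Qed.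

Lemma c0P (x : ell_inf) : c0_set x <->
  forall e : R, 0 < e -> \forall n \near \oo, `|x n| < e.
Proof. by split=> [cx|cx]; apply/cvgr0Pnorm_lt. Qed.

Lemma c0_is_ideal : is_ideal c0_set.
Proof.
split; first split.
- exact: cvg_cst.
- by move=> x y cx cy; rewrite /c0_set /= -(addr0 0); exact: cvgD.
- move=> c x cx; rewrite /c0_set /= -(mulr0 c).
  by apply: cvgM => //; exact: cvg_cst.
- move=> a x cx; have h : c0_set (amul a x).
    apply/c0P => e e0.
    have a1 : 0 < `|a| + 1 by rewrite ltr_wpDl.
    have := (c0P _).1 cx (e / (`|a| + 1)) (divr_gt0 e0 a1).
    apply: filterS => n /=; rewrite ltr_pdivlMr// => xn.
    rewrite normrM mulrC; apply: le_lt_trans xn; rewrite ler_wpM2l//.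
    by apply: le_trans (bfun_norm_ge a n) _; rewrite lerDl.
  split=> //; rewrite (_ : amul x a = amul a x)//.
  by apply: bfunP => n /=; rewrite mulrC.
Qed.

Lemma c0_closed : closed c0_set.
Proof.
move=> x clx; apply/c0P => e e0.
have e2 : 0 < e / 2 by rewrite divr_gt0.
have [y [cy xy]] := clx _ (nbhsx_ballx x _ e2).
have := (c0P _).1 cy (e / 2) e2.
apply: filterS => n /= yn.
have : `|(x - y : ell_inf) n| < e / 2.
  apply: le_lt_trans (bfun_norm_ge _ n) _.
  by move: xy; rewrite -ball_normE.
rewrite /= => xyn; rewrite -(subrK (y n) (x n)) [e]splitr.
by apply: le_lt_trans (ler_normD _ _) _; exact: ltrD.
Qed.

Lemma s0_is_subalgebra : is_subalgebra s0_set.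
Proof.
split; first split.
- move=> e e0; apply: (@harmonic_summable_sub _ set0) => [n /=|].
    by rewrite normr0 leNgt e0.
  rewrite /harmonic_summable (_ : (fun _ => _) = fun=> 0).
    rewrite (_ : series _ = cst (0 : R)); first exact: is_cvg_cst.
    by apply/funext => n; rewrite /series /= big1.
  by apply/funext => n; rewrite indicE in_set0 mul0r.
- move=> x y sx sy e e0; have e2 : 0 < e / 2 by rewrite divr_gt0.
  apply: harmonic_summable_sub (harmonic_summableU (sx _ e2) (sy _ e2)).
  move=> n /= en; have [fx|fx] := leP (e / 2) `|x n|; first by left.
  right; rewrite leNgt; apply/negP => gx; move: en; rewrite leNgt => /negP.
  by apply; rewrite [ltRHS]splitr; exact: le_lt_trans (ler_normD _ _) (ltrD fx gx).
- move=> c x sx e e0; have c1 : 0 < `|c| + 1 by rewrite ltr_wpDl.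
  apply: harmonic_summable_sub (sx _ (divr_gt0 e0 c1)) => n /= en.
  rewrite ler_pdivrMr//; apply: le_trans en _.
  by rewrite normrM mulrC ler_wpM2l// lerDl.
- move=> x y sx sy e e0; have c1 : 0 < `|y| + 1 by rewrite ltr_wpDl.
  apply: harmonic_summable_sub (sx _ (divr_gt0 e0 c1)) => n /= en.
  rewrite ler_pdivrMr//; apply: le_trans en _.
  rewrite normrM ler_wpM2l//; apply: le_trans (bfun_norm_ge y n) _.
  by rewrite lerDl.
Qed.

Lemma c0_sub_s0 : c0_set `<=` s0_set.
Proof.
move=> x /c0P cx e e0; have [N _ xN] := cx e e0.
apply: (@harmonic_summable_sub _ [set n | (n < N)%N]) => [n /= en|].
  by rewrite ltnNge; apply/negP => /xN /=; rewrite ltNge en.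
pose u n : R := \1_[set k | (k < N)%N] n * harmonic n; rewrite -[harmonic_summable _]/(cvgn (series u)).
apply: (@cvgP _ _ (series u N)); apply: cvg_near_cst.
near=> n; have Nn : (N <= n)%N by near: n; exact: nbhs_infty_ge.
rewrite /series /= (@big_cat_nat _ _ _ N)//= [X in _ + X](_ : _ = 0) ?addr0//.
rewrite big_nat_cond big1// => i /andP[/andP[Ni _] _].
by rewrite /u indicE memNset ?mul0r//=; apply/negP; rewrite -leqNgt.
Unshelve. all: by end_near. Qed.

Definition c0 : closed_ideal ell_inf := ClosedIdeal c0_is_ideal c0_closed.

Definition s0 : subalgebra ell_inf := Subalgebra s0_is_subalgebra.

Definition Y_set : set (stone_cech R nat) :=
  \bigcup_(A in harmonic_summable) closure (@stone_cech_emb R nat @` A).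

End sequence_algebras.
Arguments c0_set R : clear implicits.
Arguments c0 R : clear implicits.
Arguments s0_set R : clear implicits.
Arguments s0 R : clear implicits.
Arguments s00_set R : clear implicits.
Arguments Y_set R : clear implicits.
Notation ell_inf R := (bfun R nat).

(* Main.v *)
Require Import Defs.
From HB Require Import structures.
From mathcomp Require Import all_boot all_order all_algebra.
From mathcomp Require Import all_classical all_reals all_analysis.
From mathcomp Require Import lra zify.

Import Order.TTheory GRing.Theory Num.Theory.
Import numFieldNormedType.Exports.

Local Open Scope classical_set_scope.
Local Open Scope ring_scope.

(** The sets with convergent harmonic sum form an ideal of subsets of [nat]:
    they are stable under subsets and finite unions, contain every finite set,
    and do not contain [nat].  All five claims rest on this.

    - [s0] is an ideal because multiplying by a bounded sequence rescales the
      threshold [e]; it is closed because a uniform error [e / 2] only halves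
      the threshold ([s0_ideal], [s0_closed]).
    - A unit would have to fix the characteristic function of every singleton,
      hence be constantly 1, against the divergence of the harmonic series
      ([s0_nonunital]).
    - Erasing the entries of [x] below [e / 2] moves [x] by at most [e / 2] and
      leaves a summable support ([s00_dense]).
    - Restriction along the embedding of [nat] maps [C0 Y] isometrically onto
      [s0].  Since [nat] is discrete, the closures in the compactification of
      the sets [A] are clopen and cut out the same [A] on [nat]
      ([beta_closure_open], [beta_closure_emb]).  Those of the summable [A]
      thus form a directed open cover of [Y], so a compact set [`|f| >= e] lies
      in one of them and its trace on [nat] is summable
      ([compact_sub_beta_closure], [restrict_s0]).  Conversely a sequence [x]
      of [s0] extends continuously to the compactification, and the extension
      is small off the closure of [`|x| >= e], which lies in [Y]
      ([restrict_surj]).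
    - Each [S : set nat] is a branch of the binary tree; numbering its nodes
      heap-wise, with root 1 and children [2 n] and [2 n + 1], gives a set with
      exactly one element in each dyadic block [2 ^ n, 2 ^ n.+1[.  These sets
      are summable ([branch_summable]), infinite, and two different ones have
      a finite intersection ([branch_almost_disjoint]).  In [s0 / c0] consider
      the classes of sequences supported by finitely many branches.  Reading
      such a sequence along each branch gives a finitely supported family in
      [ell_inf / c0]; this is an algebra morphism, and it is isometric since
      the norm modulo [c0] is a limit superior ([quot_c0_norm_leP]), which on
      a finite union is the maximum over the pieces ([coords_norm]).  It is
      onto because almost disjoint pieces can be filled independently up to
      finitely many terms ([coords_surj]). *)

(** * Finite unions, and isometric isomorphisms *)

Section preliminaries.

(** For use with the two ideals of sets of naturals in play: the harmonically
    summable sets, and the sets that are avoided from some point on. *)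
Lemma bigcup_finite_ind (I T : Type) (P : set T -> Prop) (F : set I)
    (A : I -> set T) :
  P set0 -> (forall B C, P B -> P C -> P (B `|` C)) ->
  finite_set F -> (forall i, F i -> P (A i)) -> P (\bigcup_(i in F) A i).
Proof.
move=> P0 PU /(@finite_seqP {classic I})[s ->].
elim: s => [|i s IHs] PA; first by rewrite set_nil bigcup_set0.
have -> : [set` i :: s] = i |` [set` s].
  by apply/seteqP; split => j /=; rewrite in_cons => /predU1P.
rewrite bigcup_setU1; apply: PU; first by apply: PA; rewrite /= mem_head.
by apply: IHs => j /= js; apply: PA; rewrite /= in_cons js orbT.
Qed.

Context {R : realType}.

Lemma isometric_isomorphism (A B : normedAlgType R) (f : A -> B) :
  (forall x y, f (x + y) = f x + f y) ->
  (forall (c : R) x, f (c *: x) = c *: f x) ->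
  (forall x y, f (amul x y) = amul (f x) (f y)) ->
  (forall x, `|f x| = `|x|) -> (forall y, exists x, f x = y) ->
  isometrically_isomorphic A B.
Proof.
move=> fD fZ fM fN fS.
have linf : linear f by move=> c x y; rewrite fD fZ.
pose g : {linear A -> B} := HB.pack f (GRing.isLinear.Build R A B _ f linf).
have [h hK] := choice fS.
have finj : injective f.
  move=> x y xy; apply/eqP; rewrite -subr_eq0 -normr_eq0 -fN -scaleN1r fD fZ.
  by rewrite xy scaleN1r subrr normr0.
exists g; split => //.
by exists h => [x|y]; [apply: finj; rewrite hK|exact: hK].
Qed.

(** The inverse of an isometric algebra isomorphism inherits its linearity: an
    isomorphism can thus be given by its explicit direction, restriction of
    functions say, even if the wanted one, extension, involves choices. *)
Lemma isometrically_isomorphic_sym (A B : normedAlgType R) :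
  isometrically_isomorphic A B -> isometrically_isomorphic B A.
Proof.
move=> [f [[g fK gK] fM fN]]; have fI := can_inj fK.
apply: (@isometric_isomorphism _ _ g) => [x y|c x|x y|x|y].
- by apply: fI; rewrite linearD !gK.
- by apply: fI; rewrite linearZ !gK.
- by apply: fI; rewrite fM !gK.
- by rewrite -fN gK.
- by exists (f y).
Qed.

Lemma harmonic_summable_bigcup (I : Type) (F : set I) (A : I -> set nat) :
  finite_set F -> (forall i, F i -> harmonic_summable (R := R) (A i)) ->
  harmonic_summable (R := R) (\bigcup_(i in F) A i).
Proof.
apply: bigcup_finite_ind; last exact: harmonic_summableU.
have [[S0 _ _] _] := s0_is_subalgebra (R := R).
by apply: harmonic_summable_sub (S0 _ ltr01).
Qed.

End preliminaries.

(** * The ideal s0 *)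

Section closedness_and_density.
Context {R : realType}.
Local Notation ell_inf := (ell_inf R).

Lemma s0_ideal : is_ideal (s0_set R).
Proof.
have [subS SM] := s0_is_subalgebra (R := R); split => // a x Sx.
have -> : amul x a = amul a x by apply: bfunP => n /=; rewrite mulrC.
suff : s0_set R (amul a x) by [].
move=> e e0; have a1 : 0 < `|a| + 1 by rewrite ltr_wpDl.
apply: harmonic_summable_sub (Sx _ (divr_gt0 e0 a1)) => n /= en.
rewrite ler_pdivrMr//; apply: le_trans en _; rewrite normrM mulrC.
by rewrite ler_wpM2l//; apply: le_trans (bfun_norm_ge a n) _; rewrite lerDl.
Qed.

(** A sequence within [e / 2] of [x] exceeds [e / 2] wherever [x] exceeds [e]. *)
Lemma s0_closed : closed (s0_set R).
Proof.
move=> x clx e e0; have e2 : 0 < e / 2 by rewrite divr_gt0.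
have [y [Sy xy]] := clx _ (nbhsx_ballx x _ e2).
apply: harmonic_summable_sub (Sy _ e2) => n /= en.
have : `|(x - y : ell_inf) n| < e / 2.
  by apply: le_lt_trans (bfun_norm_ge _ n) _; move: xy; rewrite -ball_normE.
rewrite /= => xyn; rewrite leNgt; apply/negP => yn.
move: en; rewrite leNgt => /negP; apply.
rewrite -(subrK (y n) (x n)) [e]splitr.
by apply: le_lt_trans (ler_normD _ _) _; exact: ltrD.
Qed.

Lemma s00_sub_s0 : s00_set R `<=` s0_set R.
Proof.
move=> x Sx e e0; apply: harmonic_summable_sub Sx => n /= en.
by rewrite -normr_gt0; exact: lt_le_trans en.
Qed.

Lemma s00_subspace : is_subspace (s00_set R).
Proof.
split.
- have := s0_ideal.1; case=> /(_ 1 ltr01) S0 _ _.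
  by apply: harmonic_summable_sub S0 => n /=; rewrite eqxx.
- move=> x y Sx Sy; apply: harmonic_summable_sub (harmonic_summableU Sx Sy) => n /=.
  have [->|] := eqVneq (x n) 0; last by left.
  by rewrite add0r; right.
- move=> c x Sx; apply: harmonic_summable_sub Sx => n /=.
  by apply: contra_neq => ->; rewrite mulr0.
Qed.

Lemma chi_bounded (A : set nat) : bounded_fun (\1_A : nat -> R).
Proof.
apply/Defs.bounded_funP; exists 1 => n.
by rewrite indicE; case: (_ \in _); rewrite ?normr1 ?normr0.
Qed.

Definition chi (A : set nat) : ell_inf := BFun (chi_bounded A).

Lemma chi_in (A : set nat) n : A n -> chi A n = 1.
Proof. by move=> An; rewrite /= indicE mem_set. Qed.

Lemma chi_out (A : set nat) n : ~ A n -> chi A n = 0.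
Proof. by move=> An; rewrite /= indicE memNset. Qed.

Lemma mask_in (A : set nat) (x : ell_inf) n : A n -> amul (chi A) x n = x n.
Proof. by move=> An; rewrite -[LHS]/(chi A n * x n) chi_in// mul1r. Qed.

Lemma mask_out (A : set nat) (x : ell_inf) n : ~ A n -> amul (chi A) x n = 0.
Proof. by move=> An; rewrite -[LHS]/(chi A n * x n) chi_out// mul0r. Qed.

Lemma chi1_c0 n : c0_set R (chi [set n]).
Proof.
apply: cvg_near_cst; exists n.+1 => // k /= nk.
by rewrite -[LHS]/(chi [set n] k) chi_out//= => kn; move: nk; rewrite kn ltnn.
Qed.

(** Every point of [s0] is approximated by its truncations, which erase the
    entries below a threshold. *)
Lemma s00_dense : dense [set x : subalg (s0 R) | s00_set R (\val x)].
Proof.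
move=> O [x Ox] oO.
have /nbhs_ballP[e /= e0 eO] : nbhs x O by exact: open_nbhs_nbhs.
have Sx : s0_set R (\val x) by have := valP x; rewrite inE.
have e2 : 0 < e / 2 by rewrite divr_gt0.
pose y : ell_inf := amul (chi [set n | e / 2 <= `|\val x n|]) (\val x).
have y00 : s00_set R y.
  apply: harmonic_summable_sub (Sx _ e2) => n /=.
  by move=> /eqP yn; apply: contrapT => en; apply: yn; exact: mask_out.
pose y' : subalg (s0 R) := exist _ y (mem_set (s00_sub_s0 _ y00)).
exists y'; split=> //; apply: eO; rewrite -ball_normE /=.
apply: (@le_lt_trans _ _ (e / 2)); last by rewrite ltr_pdivrMr// ltr_pMr// ltr1n.
apply: bfun_norm_le => [|n]; first exact: ltW.
have [en|en] := leP (e / 2) `|\val x n|.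
  rewrite [X in `|X|](_ : _ = \val x n - y n)//.
  by rewrite mask_in// subrr normr0 ltW.
rewrite [X in `|X|](_ : _ = \val x n - y n)//.
by rewrite mask_out ?subr0 ?ltW//=; apply/negP; rewrite -ltNge.
Qed.

(** Testing a unit on the characteristic functions of singletons, which lie in
    [s0] although [chi setT] does not, forces it to be constantly 1. *)
Lemma s0_nonunital : ~ unital (subalg (s0 R)).
Proof.
move=> [u uE].
have u1 n : \val u n = 1.
  pose d : subalg (s0 R) := exist _ (chi [set n]) (mem_set (c0_sub_s0 (chi1_c0 n))).
  have [ud _] := uE d.
  have : \val u n * chi [set n] n = chi [set n] n.
    exact: (congr1 (fun x : subalg (s0 R) => (\val x : ell_inf) n) ud).
  by rewrite chi_in// mulr1.
have /(_ 1 ltr01) : s0_set R (\val u) by have := valP u; rewrite inE.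
rewrite [X in harmonic_summable X](_ : _ = setT); last first.
  by apply/seteqP; split => // n _ /=; rewrite u1 normr1.
rewrite /harmonic_summable indicT.
rewrite (_ : (fun _ => _) = @harmonic R); first exact: dvg_harmonic.
by apply/funext => n; rewrite mul1r.
Qed.

End closedness_and_density.

(** * The Stone-Cech compactification of the naturals *)

Section compactification.
Context {R : realType}.
Local Notation ell_inf := (ell_inf R).
Local Notation bN := (stone_cech R nat).
Local Notation emb := (@stone_cech_emb R nat).
Local Notation cl A := (closure (emb @` A)).

(** Used to bound an extension, or to compute it, from its values on [nat]. *)
Lemma beta_closed_transfer (F : bN -> R) (A : set nat) (C : set R) :
  continuous F -> closed C -> (forall n, A n -> C (F (emb n))) ->
  forall p, cl A p -> C (F p).
Proof.
move=> cF cC FA p clp; have := (continuous_closedP F).1 cF C cC.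
move=> /closure_id; rewrite -[C (F p)]/((F @^-1` C) p) => ->.
by apply: closureS clp => _ [n An <-]; exact: FA.
Qed.

Lemma beta_closure_cover (A : set nat) (p : bN) : cl A p \/ cl (~` A) p.
Proof.
suff : closure (emb @` A `|` emb @` (~` A)) p by rewrite closureU.
rewrite -image_setU setUv.
move=> B; rewrite nbhsE => -[V [oV Vp] sVB].
have [q [Vq Eq]] := @stone_cech_dense R nat V (ex_intro _ p Vp) oV.
by exists q; split => //; exact: sVB.
Qed.

(** The universal property concerns functions with values in [0, 1]; an affine
    change of the values reduces bounded sequences to that case. *)
Lemma beta_extension (x : ell_inf) :
  exists F : bN -> R, continuous F /\ forall n, F (emb n) = x n.
Proof.
pose M := `|x| + 1; have M0 : 0 < M by rewrite ltr_wpDl.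
have xM n : `|x n| <= M.
  by apply: le_trans (bfun_norm_ge x n) _; rewrite lerDl.
have cn (f : nat -> R) : continuous f.
  by apply/continuousP => U _; exact: discrete_open.
have [|G [cG GE]] := @stone_cech_ext R nat (fun n => (x n + M) / (2 * M)) (cn _).
  move=> n; have := xM n; rewrite ler_norml => /andP[Mx xM'].
  have M2 : 0 < 2 * M by rewrite mulr_gt0.
  by rewrite ler_pdivlMr// ler_pdivrMr// !mul0r mul1r; apply/andP; split; lra.
exists (fun p => G p * (2 * M) - M); split => [p|n].
  exact: (cvgB (cvgM (cG p) (cvg_cst (2 * M))) (cvg_cst M)).
by rewrite GE divfK ?addrK// mulf_neq0 ?gt_eqF.
Qed.

(** The extension of [chi A] takes only the values 0 and 1, which separates the
    closures of [A] and of its complement. *)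
Lemma beta_closure_sep (A : set nat) :
  exists F : bN -> R, [/\ continuous F, forall p, cl A p -> F p = 1 &
    forall p, cl (~` A) p -> F p = 0].
Proof.
have [F [cF FE]] := beta_extension (chi A).
exists F; split => // p.
  apply: (@beta_closed_transfer F A [set r | r = 1] cF (@closed_eq R 1)).
  by move=> n An; rewrite FE chi_in.
apply: (@beta_closed_transfer F (~` A) [set r | r = 0] cF (@closed_eq R 0)).
by move=> n An; rewrite FE chi_out.
Qed.

Lemma beta_closure_open (A : set nat) : open (cl A).
Proof.
have [F [cF F1 F0]] := beta_closure_sep A.
have -> : cl A = F @^-1` [set r | r != 0].
  apply/seteqP; split => p /=; first by move=> /F1 ->; rewrite oner_eq0.
  by case: (beta_closure_cover A p) => // /F0 ->; rewrite eqxx.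
by apply: (continuousP _).1 => //; exact: open_neq.
Qed.

Lemma beta_closure_emb (A : set nat) n : cl A (emb n) -> A n.
Proof.
have [F [_ F1 F0]] := beta_closure_sep A.
move=> /F1 Fn; apply: contrapT => An; move/eqP: Fn.
rewrite F0; first by rewrite eq_sym oner_eq0.
by apply: subset_closure; exists n.
Qed.

(** Compactness is intrinsic: the ambient cluster point of a filter on [K] is in
    [K], hence in [Y], and neighborhoods in [Y] are traces of ambient ones. *)
Lemma compact_preimage_set_val (X : topologicalType) (Y K : set X) :
  compact K -> K `<=` Y -> compact (set_val @^-1` K : set Y).
Proof.
move=> cK KY F FF FK.
pose v : Y -> X := set_val.
have [|p [Kp clp]] := cK (v @ F) (fmap_proper_filter v FF); first exact: FK.
exists (exist _ p (mem_set (KY _ Kp))); split => // A B FA.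
move=> [_ [[B' oB' <-] /= B'p] sB].
have [||q [[a Aa aq] B'q]] := clp (v @` A) B'.
- by apply: (@filterS _ F _ A _ _ FA) => a Aa; exists a.
- exact: open_nbhs_nbhs.
by exists a; split => //; apply: sB; rewrite /preimage /= -[set_val a]/(v a) aq.
Qed.

Lemma harmonic_summable1 n : harmonic_summable (R := R) [set n].
Proof.
apply: harmonic_summable_sub (c0_sub_s0 (chi1_c0 n) ltr01) => _ -> /=.
by rewrite -[\1__ _]/(chi [set n] n) chi_in// normr1.
Qed.

Lemma Y_emb n : Y_set R (emb n).
Proof.
exists [set n]; first exact: harmonic_summable1.
by apply: subset_closure; exists n.
Qed.

Definition embY n : Y_set R := exist _ (emb n) (mem_set (Y_emb n)).

Lemma restrict_bounded (f : bfun R (Y_set R)) :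
  bounded_fun (fun n => f (embY n)).
Proof.
by apply/Defs.bounded_funP; exists `|f| => n; exact: bfun_norm_ge.
Qed.

Definition restrict (f : bfun R (Y_set R)) : ell_inf := BFun (restrict_bounded f).

(** The sets [cl A] with [A] summable form an open cover of [Y] that is directed,
    since two summable sets have a summable union: one of its members contains
    a given compact set. *)
Lemma compact_sub_beta_closure (K : set (Y_set R)) : compact K ->
  exists2 A, harmonic_summable (R := R) A & forall y, K y -> cl A (set_val y).
Proof.
pose G := filter_from (@harmonic_summable R) (fun A : set nat => [set B | A `<=` B]).
have FG : Filter G.
  apply: filter_from_filter; first by exists [set 0%N]; exact: harmonic_summable1.
  move=> A B sA sB; exists (A `|` B); first exact: harmonic_summableU.
  by move=> C ABC; split; apply: subset_trans ABC; [left|right].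
move=> /compact_near_coveringP-/(_ _ G (fun A y => cl A (set_val y)) FG).
case=> [y _|A sA clA]; last by exists A => // y; exact: (clA A).
have [A sA clA] := set_valP y.
exists (set_val @^-1` cl A, [set B | A `<=` B]); first split.
- apply: open_nbhs_nbhs; split => //.
  by exists (cl A) => //; exact: beta_closure_open.
- by exists A.
- move=> [y' B] /= [clAy' AB]; apply: closureS clAy'; exact: image_subset.
Qed.

Lemma restrict_s0 (f : bfun R (Y_set R)) :
  C0_set f -> s0_set R (restrict f).
Proof.
move=> [_ Cf] e e0; pose n := Num.truncn e^-1.
have ne : n.+1%:R^-1 <= e.
  by rewrite -[leRHS]invrK lef_pV2 ?posrE ?invr_gt0// ltW// truncnS_gt.
have [A sA clA] := compact_sub_beta_closure _ (Cf n).
apply: harmonic_summable_sub sA => k /= ek.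
exact: beta_closure_emb (clA (embY k) (le_trans ne ek)).
Qed.

(** The naturals are dense in [Y], so that they see the supremum of [`|f|]. *)
Lemma restrict_norm (f : bfun R (Y_set R)) :
  continuous f -> `|restrict f| = `|f|.
Proof.
move=> cf; apply/eqP; rewrite eq_le; apply/andP; split.
  by apply: bfun_norm_le => // n; exact: (bfun_norm_ge f (embY n)).
apply: bfun_norm_le => // y; rewrite leNgt; apply/negP => fy.
have oU : open [set z | `|restrict f| < `|f z|].
  have cnf : continuous (fun z => `|f z|).
    by move=> z; apply: continuous_comp (cf z) _; exact: norm_continuous.
  exact: (continuousP _).1 cnf _ (@open_gt _ _).
have [W oW WE] := oU.
have Wf z : W (set_val z) = (`|restrict f| < `|f z|) :> Prop.
  exact: (congr1 (fun U : set (Y_set R) => U z) WE).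
have Wy : W (set_val y) by rewrite Wf.
have [p [Wp [n _ np]]] := @stone_cech_dense R nat W (ex_intro _ _ Wy) oW.
have : W (set_val (embY n)) by rewrite -[set_val _]/(emb n) np.
by rewrite Wf ltNge (bfun_norm_ge (restrict f) n).
Qed.

(** The set where the extension [F] of [x] has modulus at least [n.+1%:R^-1] is
    compact, and lies in [Y]: off the closure of the summable set where [`|x|] is
    at least [n.+2%:R^-1], the bound [n.+2%:R^-1] passes from [x] to [F]. *)
Lemma restrict_surj (x : ell_inf) : s0_set R x ->
  exists2 f : bfun R (Y_set R), C0_set f & restrict f = x.
Proof.
move=> sx; have [F [cF FE]] := beta_extension x.
have F_le A c p : (forall n, A n -> `|x n| <= c) -> cl A p -> `|F p| <= c.
  move=> xc; apply: (@beta_closed_transfer F A [set r | `|r| <= c] cF).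
    have cn : continuous (fun r : R => `|r|) by exact: norm_continuous.
    exact: (continuous_closedP _).1 cn _ (@closed_le _ c).
  by move=> n An; rewrite /= FE; exact: xc.
have bF : bounded_fun (fun y : Y_set R => F (set_val y)).
  apply/Defs.bounded_funP; exists `|x| => y.
  apply: (F_le setT); first by move=> n _; exact: bfun_norm_ge.
  have [//|] := beta_closure_cover setT (set_val y).
  by rewrite setCT image_set0 closure0.
exists (BFun bF); last by apply: bfunP => n; exact: FE.
have cv := @initial_continuous (Y_set R) _ set_val.
split=> [y|n]; first by apply: continuous_comp (cv y) _; exact: cF.
pose K := [set p : bN | n.+1%:R^-1 <= `|F p|].
apply: (@compact_preimage_set_val _ (Y_set R) K).
  apply: subclosed_compact (@stone_cech_compact R nat) (subsetT _).
  have cnF : continuous (fun p => `|F p|).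
    by move=> p; apply: continuous_comp (cF p) _; exact: norm_continuous.
  exact: (continuous_closedP _).1 cnF _ (@closed_ge _ _).
move=> p Kp; have n2 : 0 < n.+2%:R^-1 :> R by rewrite invr_gt0.
exists [set k | n.+2%:R^-1 <= `|x k|]; first exact: sx.
have [//|/(F_le _ n.+2%:R^-1)] := beta_closure_cover [set k | n.+2%:R^-1 <= `|x k|] p.
move=> Fp; exfalso; move: Kp; rewrite /K /= leNgt => /negP; apply.
apply: le_lt_trans (Fp _) _; last by rewrite ltf_pV2 ?posrE// ltr_nat.
by move=> k /negP; rewrite -ltNge => /ltW.
Qed.

Lemma s0_isometric_C0 :
  isometrically_isomorphic (subalg (s0 R)) (subalg (C0 R (Y_set R))).
Proof.
apply: isometrically_isomorphic_sym.
have Sf (f : subalg (C0 R (Y_set R))) : C0_set (\val f).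
  by have := valP f; rewrite inE.
pose r (f : subalg (C0 R (Y_set R))) : subalg (s0 R) :=
  exist _ (restrict (\val f)) (mem_set (restrict_s0 _ (Sf f))).
apply: (@isometric_isomorphism _ _ _ r).
- by move=> f g; apply: val_inj; apply: bfunP.
- by move=> c f; apply: val_inj; apply: bfunP.
- by move=> f g; apply: val_inj; apply: bfunP.
- by move=> f; apply: restrict_norm; exact: (Sf f).1.
- move=> x; have [|f Cf fx] := restrict_surj (\val x).
    by have := valP x; rewrite inE.
  by exists (exist _ f (mem_set Cf)); apply: val_inj.
Qed.

End compactification.

(** * An almost disjoint family of harmonically summable sets *)

Section almost_disjoint.
Context {R : realType}.

(** The heap number of the node at depth [n] on the branch of the binary tree
    that turns right exactly at the depths in [S].  In binary, it is a leading 1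
    followed by the first [n] bits of [S]. *)
Fixpoint branch (S : set nat) (n : nat) : nat :=
  if n is m.+1 then (branch S m).*2 + (m \in S) else 1.

Lemma branch_ge (S : set nat) n : (2 ^ n <= branch S n)%N.
Proof.
elim: n => //= n IHn; rewrite expnS mul2n.
by apply: leq_trans (leq_addr _ _); rewrite leq_double.
Qed.

Lemma branch_gt0 (S : set nat) n : (0 < branch S n)%N.
Proof. by apply: leq_trans (branch_ge S n); rewrite expn_gt0. Qed.

Lemma branch_gt_id (S : set nat) n : (n < branch S n)%N.
Proof. exact: leq_trans (ltn_expl n (ltnSn 1)) (branch_ge S n). Qed.

Lemma branch_mono (S : set nat) : {homo branch S : m n / (m < n)%N}.
Proof.
apply: homo_ltn; first exact: ltn_trans.
move=> n /=; apply: leq_trans (leq_addr _ _).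
by rewrite -addnn -[X in (X < _)%N]addn0 ltn_add2l branch_gt0.
Qed.

(** A heap number determines the path from the root to its node, as can be read
    off by repeated halving. *)
Lemma branch_eq (S T : set nat) m n : branch S m = branch T n ->
  m = n /\ forall k, (k < n)%N -> (k \in S) = (k \in T).
Proof.
elim: m n => [|m IHm] [|n] //=.
- have := branch_gt0 T n; lia.
- have := branch_gt0 S m; lia.
move=> e; have [|mn IHk] := IHm n; first by lia.
subst m; split=> // k; rewrite ltnS leq_eqVlt => /predU1P[->|]; last exact: IHk.
by move: e; case: (n \in S); case: (n \in T) => //=; lia.
Qed.

Lemma branch_almost_disjoint (S T : set nat) : S <> T ->
  \forall m \near \oo, forall n, branch T n <> branch S m.
Proof.
move=> ST; have [k kST] : exists k, (k \in S) <> (k \in T).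
  apply: contrapT => kST; apply: ST; apply/seteqP.
  have {}kST k : (k \in S) = (k \in T) by apply: contrapT => h; apply: kST; exists k.
  by split=> k /mem_set; [rewrite kST|rewrite -kST] => /set_mem.
exists k.+1 => // m /= km n /branch_eq[_ /(_ k km)] h.
by apply: kST; rewrite h.
Qed.

(** There is one element in each dyadic block [2 ^ n, 2 ^ n.+1[, of weight at most
    [2^-1 ^+ n]: the comparison is with a geometric series, whose partial sums
    are [2 - 2 * 2^-1 ^+ m]. *)
Lemma branch_summable (S : set nat) :
  harmonic_summable (R := R) (range (branch S)).
Proof.
set A := range _; pose u n : R := \1_A n * harmonic n.
have u0 n : 0 <= u n by rewrite mulr_ge0// harmonic_ge0.
have uA n : ~ A n -> u n = 0 by move=> An; rewrite /u indicE memNset// mul0r.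
have mono : nondecreasing_seq (series u).
  by apply: nondecreasing_series => n _ _; exact: u0.
have bound m : series u (branch S m) <= 2 - 2 * 2^-1 ^+ m.
  elim: m => [|m IHm].
    rewrite /series /= big_nat1 uA ?expr0 ?mulr1 ?subrr// => -[n _ /= n0].
    by have := branch_gt0 S n; rewrite n0.
  have lt_m : (branch S m < branch S m.+1)%N by exact: branch_mono.
  have rest0 : \sum_((branch S m).+1 <= j < branch S m.+1) u j = 0.
    rewrite big_nat_cond big1//.
    move=> j /andP[/andP[mj jm] _]; apply: uA => -[n _ nj].
    (* an element strictly between two consecutive ones would have an index
       strictly between m and m.+1 *)
    have : (m < n)%N.
      rewrite ltnNge; apply/negP; rewrite leq_eqVlt => /predU1P[nm|/(branch_mono S)].
        by move: mj; rewrite -nj nm ltnn.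
      by rewrite nj => /(ltn_trans mj); rewrite ltnn.
    rewrite leq_eqVlt => /predU1P[mn|/(branch_mono S)].
      by move: jm; rewrite -nj -mn ltnn.
    by rewrite nj => /(ltn_trans jm); rewrite ltnn.
  have seriesS : series u (branch S m.+1) = series u (branch S m) + u (branch S m).
    rewrite -[LHS]/(\sum_(0 <= j < branch S m.+1) u j).
    move: (branch S m.+1) lt_m rest0 => b lt_m rest0.
    by rewrite (big_cat_nat _ (ltnW lt_m))//= (big_ltn lt_m) rest0 addr0.
  have um : u (branch S m) <= 2^-1 ^+ m.
    rewrite /u indicE mem_set ?mul1r; last by exists m.
    rewrite /harmonic /= exprVn lef_pV2 ?posrE ?exprn_gt0//.
    by rewrite -natrX ler_nat (leq_trans (branch_ge S m)).
  by rewrite seriesS exprS mulrA divff// mul1r; lra.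
apply: nondecreasing_is_cvgn => //; exists 2 => _ [n _ <-].
apply: le_trans (mono _ _ (ltnW (branch_gt_id S n))) _.
apply: le_trans (bound n) _; rewrite gerBl mulr_ge0// exprn_ge0// invr_ge0.
Qed.

End almost_disjoint.

(** * A direct sum inside s0 / c0 *)

Section quotient_norm.
Context {R : realType}.
Local Notation ell_inf := (ell_inf R).

(** The quotient norm modulo [c0] is the limit superior of [`|v x n|]: a class
    changes its representative by null sequences, and conversely erasing
    finitely many terms is such a change.  The embedding [v] into [ell_inf] makes
    the result apply both to [ell_inf] and to its subalgebra [s0]. *)
Lemma quot_c0_norm_leP (A : normedAlgType R) (J : closed_ideal A)
    (v : A -> ell_inf) :
  (forall x y, v (x - y) = v x - v y) -> (forall x, `|v x| = `|x|) ->
  (forall x, (J : set A) x <-> c0_set R (v x)) ->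
  (forall (B : set nat) x, exists y, v y = amul (chi B) (v x)) ->
  forall x (c : R), 0 <= c -> `|quot_pi J x| <= c <->
    forall e, 0 < e -> \forall n \near \oo, `|v x n| <= c + e.
Proof.
move=> vB vN vJ vmask x c c0; rewrite -[`|quot_pi J x|]/(quot_norm _); split.
  move=> xc e e0; have e2 : 0 < e / 2 by rewrite divr_gt0.
  have [y yx ny] := quot_norm_adherent (quot_pi J x) e2.
  have /vJ/c0P/(_ _ e2) : (J : set A) (x - y) by apply/quot_piP.
  apply: filterS => n; rewrite vB => xyn.
  have yn := bfun_norm_ge (v y) n; rewrite -[bfun_norm _]/(`|v y|) vN in yn.
  rewrite -(subrK (v y n) (v x n)); apply: le_trans (ler_normD _ _) _.
  rewrite -[_ - v y n]/((v x - v y : ell_inf) n); lra.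
move=> xc; apply/ler_addgt0Pr => e e0; have [N _ xN] := xc e e0.
have [y yE] := vmask [set n | (N <= n)%N] x.
have <- : quot_pi J y = quot_pi J x.
  apply/esym/quot_piP/vJ; rewrite vB yE; apply: cvg_near_cst.
  exists N => // n Nn.
  by rewrite -[LHS]/(v x n - amul (chi [set n | (N <= n)%N]) (v x) n) mask_in// subrr.
apply: le_trans (quot_norm_le _ _) _; rewrite -vN yE.
apply: bfun_norm_le => [|n]; first by rewrite addr_ge0// ltW.
have [Nn|nN] := leqP N n; first by rewrite mask_in//; exact: xN.
rewrite mask_out; last by apply/negP; rewrite -ltnNge.
by rewrite normr0 addr_ge0// ltW.
Qed.

End quotient_norm.

Section direct_sum_copy.
Context {R : realType}.
Local Notation ell_inf := (ell_inf R).
Local Notation s0 := (s0 R).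
Local Notation lq := (quotalg (c0 R)).
Local Notation sq := (quotalg (restricted_ideal s0 (c0 R))).
Local Notation lpi := (quot_pi (c0 R)).
Local Notation spi := (quot_pi (restricted_ideal s0 (c0 R))).

Lemma s0_val (z : subalg s0) : s0_set R (\val z).
Proof. by have := valP z; rewrite inE. Qed.

Lemma lq_norm_leP (x : ell_inf) (c : R) : 0 <= c ->
  `|lpi x| <= c <-> forall e, 0 < e -> \forall n \near \oo, `|x n| <= c + e.
Proof.
by apply: (@quot_c0_norm_leP _ _ _ id) => // B y; exists (amul (chi B) y).
Qed.

Lemma sq_norm_leP (z : subalg s0) (c : R) : 0 <= c ->
  `|spi z| <= c <-> forall e, 0 < e -> \forall n \near \oo, `|\val z n| <= c + e.
Proof.
apply: (@quot_c0_norm_leP _ _ (restricted_ideal s0 (c0 R)) (fun y : subalg s0 => \val y)) => // B y.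
have [_ /(_ (chi B) _ (s0_val y))[sy _]] := s0_ideal (R := R).
by exists (exist _ (amul (chi B) (\val y)) (mem_set sy) : subalg s0).
Qed.

Lemma pull_bounded (f : nat -> nat) (x : ell_inf) :
  bounded_fun (fun n => x (f n)).
Proof. by apply/Defs.bounded_funP; exists `|x| => n; exact: bfun_norm_ge. Qed.

Definition pull (f : nat -> nat) (x : ell_inf) : ell_inf :=
  BFun (pull_bounded f x).

Section pull_quotient.
Variable f : nat -> nat.
Hypothesis f_mono : {homo f : m n / (m < n)%N}.

Lemma pull_near (P : set nat) :
  (\forall n \near \oo, P n) -> \forall k \near \oo, P (f k).
Proof.
have f_ge n : (n <= f n)%N.
  by elim: n => // n IHn; apply: leq_ltn_trans IHn _; exact: f_mono.
by move=> [N _ NP]; exists N => // k /= Nk; apply: NP; exact: leq_trans (f_ge k).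
Qed.

Lemma pull_c0 (x : ell_inf) : c0_set R x -> c0_set R (pull f x).
Proof. by move=> /c0P cx; apply/c0P => e /cx /pull_near. Qed.

(** The map induced by [pull f] on classes modulo [c0]; the choice of a
    representative does not matter by [qpull_pi]. *)
Definition qpull (q : sq) : lq := lpi (pull f (\val (quot_repr q))).

Lemma qpull_pi (z : subalg s0) : qpull (spi z) = lpi (pull f (\val z)).
Proof.
apply/quot_piP; have : spi (quot_repr (spi z)) = spi z by exact: quot_reprK.
by move=> /quot_piP /pull_c0; congr c0_set; exact: bfunP.
Qed.

Lemma qpullD p q : qpull (p + q) = qpull p + qpull q.
Proof.
have [x <-] := quot_surj p; have [y <-] := quot_surj q.
rewrite -quot_piD !qpull_pi -quot_piD; congr lpi; exact: bfunP.
Qed.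

Lemma qpullZ c q : qpull (c *: q) = c *: qpull q.
Proof.
have [x <-] := quot_surj q.
rewrite [c *: spi x]quot_piZ !qpull_pi [RHS]quot_piZ; congr lpi; exact: bfunP.
Qed.

Lemma qpullM p q : qpull (amul p q) = amul (qpull p) (qpull q).
Proof.
have [x <-] := quot_surj p; have [y <-] := quot_surj q.
rewrite [amul (spi x) _]quot_piM !qpull_pi [RHS]quot_piM.
by congr lpi; exact: bfunP.
Qed.

Lemma qpull_norm q : `|qpull q| <= `|q|.
Proof.
have [x <-] := quot_surj q; rewrite qpull_pi.
apply/lq_norm_leP => // e e0; apply: (pull_near [set n | `|\val x n| <= `|spi x| + e]).
by move: e e0; apply/sq_norm_leP.
Qed.

End pull_quotient.

Variables (I : Type) (g : I -> set nat).
Hypothesis g_inj : injective g.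
Local Notation comb i := (branch (g i)).

Definition supported (F : set I) (z : ell_inf) :=
  forall n, z n <> 0 -> (\bigcup_(i in F) range (comb i)) n.

(** The finite set of branches depends on the class, which is what makes this
    subalgebra a direct sum rather than a product. *)
Definition tracked : set sq :=
  [set q | exists F z, [/\ finite_set F, spi z = q & supported F (\val z)]].

Lemma tracked_subalgebra : is_subalgebra tracked.
Proof.
split; first split.
- by exists set0, 0; split; [exact: finite_set0|exact: quot_pi0|].
- move=> _ _ [F [x [fF <- xF]]] [G [y [fG <- yG]]].
  exists (F `|` G), (x + y); split; [by rewrite finite_setU|exact: quot_piD|].
  move=> n; rewrite bigcup_setU.
  have [xn xyn|/xF] := pselect (\val x n = 0); last by left.
  by right; apply: yG => yn; apply: xyn; rewrite -[LHS]/(\val x n + \val y n) xn yn addr0.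
- move=> c _ [F [x [fF <- xF]]]; exists F, (c *: x); split => //.
    by rewrite [RHS]quot_piZ.
  move=> n cxn; apply: xF => xn; apply: cxn.
  by rewrite -[LHS]/(c * \val x n) xn mulr0.
- move=> _ _ [F [x [fF <- xF]]] [G [y [fG <- yG]]].
  exists F, (amul x y); split => //; first by rewrite [RHS]quot_piM.
  move=> n xyn; apply: xF => xn; apply: xyn.
  by rewrite -[LHS]/(\val x n * \val y n) xn mul0r.
Qed.

Definition tracked_subalg : subalgebra sq := Subalgebra tracked_subalgebra.

(** Almost disjointness, uniformly over finitely many branches: from some point
    on, the branch of [i] meets no other branch of [F]. *)
Lemma comb_avoid (F : set I) i : finite_set F ->
  \forall k \near \oo, forall j m, F j -> comb j m = comb i k -> j = i.
Proof.
move=> fF; pose hit j := [set k | j <> i /\ exists m, comb j m = comb i k].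
have : \forall k \near \oo, ~ (\bigcup_(j in F) hit j) k.
  apply: (@bigcup_finite_ind _ _ (fun B => \forall k \near \oo, ~ B k)) => //.
  - by apply: nearW => k [].
  - by move=> B C; apply: filterS2 => k Bk Ck [].
  move=> j _; have [->|ji] := pselect (j = i); first by apply: nearW => k [].
  have /branch_almost_disjoint : g i <> g j by move=> /g_inj /esym.
  by apply: filterS => k nk [_ [m]]; exact: nk.
apply: filterS => k nk j m Fj jm; apply: contrapT => ji; apply: nk.
by exists j => //; split => //; exists m.
Qed.

(** A sequence supported by the branches of [F] is eventually null along any other
    branch.  This makes the family of restrictions finitely supported. *)
Lemma qpull_out (F : set I) (z : subalg s0) i :
  finite_set F -> supported F (\val z) -> ~ F i -> qpull (comb i) (spi z) = 0.
Proof.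
move=> fF zF Fi; rewrite qpull_pi; last exact: branch_mono.
rewrite -[RHS]quot_pi0; apply/quot_piP; rewrite subr0; apply: cvg_near_cst.
have := comb_avoid F i fF; apply: filterS => k ki; apply: contrapT => zk.
by have [j Fj [m _ jm]] := zF _ zk; apply: Fi; rewrite -(ki j m Fj jm).
Qed.

Lemma tracked_finite (q : sq) : tracked q ->
  finite_set [set i | qpull (comb i) q <> 0].
Proof.
move=> [F [z [fF <- zF]]]; apply: sub_finite_set (fF) => i /=.
by move=> qi; apply: contrapT => Fi; apply: qi; exact: qpull_out fF zF Fi.
Qed.

Lemma tracked_val (q : subalg tracked_subalg) : tracked (\val q).
Proof. by have := valP q; rewrite inE. Qed.

Definition coords (q : subalg tracked_subalg) : dsum (fun _ : I => lq) :=
  DSum (tracked_finite _ (tracked_val q)).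

(** The limit superior over a finite union of branches is the largest of the
    limits superior along these branches. *)
Lemma coords_norm (q : subalg tracked_subalg) : `|coords q| = `|q|.
Proof.
apply/eqP; rewrite eq_le; apply/andP; split.
  apply: dsum_norm_le => // i; apply: qpull_norm; exact: branch_mono.
have [F [z [fF zq zF]]] := tracked_val q.
rewrite -[`|q|]/(`|\val q|) -zq; apply/sq_norm_leP => // e e0.
(* the terms of z that are too large, sorted by branch *)
pose big i := [set n | exists2 k, comb i k = n & `|coords q| + e < `|\val z n|].
have : \forall n \near \oo, ~ (\bigcup_(i in F) big i) n.
  apply: (@bigcup_finite_ind _ _ (fun B => \forall n \near \oo, ~ B n)) => //.
  - by apply: nearW => k [].
  - by move=> B C; apply: filterS2 => k Bk Ck [].
  move=> i _.
  have := dsum_norm_ge (coords q) i.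
  rewrite -[dsum_fun _ _]/(qpull (comb i) (\val q)) -zq qpull_pi; last exact: branch_mono.
  move=> /lq_norm_leP-/(_ (dsum_norm_ge0 _) e e0)[K _ zK].
  exists (comb i K) => // n /= Kn [k kn]; rewrite ltNge => /negP; apply.
  rewrite -kn; apply: (zK k); rewrite /= leqNgt; apply/negP => /(branch_mono (g i)).
  by rewrite kn ltnNge Kn.
apply: filterS => n nbig; rewrite leNgt; apply/negP => zn; apply: nbig.
have [|i Fi [k _ kn]] := zF n; last by exists i => //; exists k.
move=> zn0; move: zn; rewrite zn0 normr0 ltNge => /negP; apply.
by rewrite addr_ge0// ltW.
Qed.

(** Representatives of the components are copied along the branches.  Where two of
    these branches meet, any of the candidate values is taken: by [comb_avoid],
    this affects only finitely many terms of each branch. *)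
Lemma coords_surj (x : dsum (fun _ : I => lq)) : exists q, coords q = x.
Proof.
have repr_x i : exists y, lpi y = x i /\ `|y| < `|x i| + 1.
  have [y yx ny] := quot_norm_adherent (x i) (ltr01 : 0 < 1 :> R).
  by exists y.
have [r rE] := choice repr_x.
(* the bound by [`|x i| + 1] keeps the glued sequence bounded by [`|x| + 1] *)
pose F := [set i | x i <> 0]; have fF : finite_set F by exact: dsum_finite.
pose at_comb n (p : I * nat) := F p.1 /\ comb p.1 p.2 = n.
pose w n : R := if pselect (exists p, at_comb n p) is left h
  then r (projT1 (cid h)).1 (projT1 (cid h)).2 else 0.
have wP n : w n <> 0 -> (\bigcup_(i in F) range (comb i)) n.
  rewrite /w; case: pselect => // -[[i k] [Fi kn]] _.
  by exists i => //; exists k.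
have bw : bounded_fun (w : nat -> R^o).
  apply/Defs.bounded_funP; exists (`|x| + 1) => n; rewrite /w.
  case: pselect => [h|_]; last by rewrite normr0 addr_ge0.
  set p := projT1 _; apply: le_trans (bfun_norm_ge _ _) _.
  apply: le_trans (ltW (rE _).2) _; rewrite lerD2r; exact: (dsum_norm_ge x).
have sw : s0_set R (BFun bw).
  move=> e e0; apply: (@harmonic_summable_sub _ _ (\bigcup_(i in F) range (comb i))).
    move=> n /= ewn; apply: wP => wn; move: ewn.
    by rewrite wn normr0 leNgt e0.
  by apply: harmonic_summable_bigcup => // i _; exact: branch_summable.
pose z : subalg s0 := exist _ (BFun bw) (mem_set sw).
have tz : tracked (spi z) by exists F, z.
exists (exist _ (spi z) (mem_set tz)); apply: dsumP => i.
rewrite -[LHS]/(qpull (comb i) (spi z)).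
have [Fi|Fi] := pselect (F i); last first.
  by rewrite (qpull_out F)//; apply/esym; exact: contrapT.
rewrite qpull_pi; last exact: branch_mono.
rewrite -(rE i).1; apply/quot_piP; apply: cvg_near_cst.
have := comb_avoid F i fF; apply: filterS => k ki.
suff wk : w (comb i k) = r i k.
  by rewrite -[LHS]/(w (comb i k) - r i k) wk subrr.
rewrite /w; case: pselect => [h|[]]; last by exists (i, k).
case: (cid h) => -[j m] /= [/= Fj jm].
have ji := ki j m Fj jm; by move: jm; rewrite ji => /branch_eq[-> _].
Qed.

Lemma s0_mod_c0_contains_dsum :
  contains_copy sq (dsum (fun _ : I => lq)).
Proof.
exists tracked_subalg; apply: (@isometric_isomorphism _ _ _ coords).
- by move=> p q; apply: dsumP => i; apply: qpullD; exact: branch_mono.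
- by move=> c q; apply: dsumP => i; apply: qpullZ; exact: branch_mono.
- by move=> p q; apply: dsumP => i; apply: qpullM; exact: branch_mono.
- exact: coords_norm.
- exact: coords_surj.
Qed.

End direct_sum_copy.

Theorem theorem4p2 (R : realType) :
  [/\ is_ideal (s0_set R) /\ closed (s0_set R),
      ~ unital (subalg (s0 R)),
      [/\ s00_set R `<=` s0_set R, is_subspace (s00_set R)
        & dense [set x : subalg (s0 R) | s00_set R (\val x)]],
      isometrically_isomorphic (subalg (s0 R)) (subalg (C0 R (Y_set R)))
    & forall I : Type, ([set: I] #= [set: set nat])%card ->
        contains_copy (quotalg (restricted_ideal (s0 R) (c0 R)))
                      (dsum (fun _ : I => quotalg (c0 R)))].
Proof.
split.
- by split; [exact: s0_ideal|exact: s0_closed].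
- exact: s0_nonunital.
- by split; [exact: s00_sub_s0|exact: s00_subspace|exact: s00_dense].
- exact: s0_isometric_C0.
- move=> I /card_set_bijP[g [_ g_inj _]].
  apply: (@s0_mod_c0_contains_dsum R I g) => i j.
  by apply: g_inj; rewrite in_setT.
Qed.
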